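(* Let $n\ge 2$, let $\mathcal{U}\subseteq\mathbb{R}^n$ be a nonempty open set, and let $\mathbf{X}:\mathcal{U}\to\mathbb{R}^n$ be of class $\mathcal{C}^1$. Let $\Gamma=\{\gamma(t)\,|\,0\le t<T\}\subset\mathcal{U}$, with $T>0$, be the orbit of a (nonconstant) $T$-periodic solution $\gamma$ of the autonomous differential system $\frac{d\mathbf{x}}{dt}=\mathbf{X}(\mathbf{x})$. Let $\mathbf{f}=(f_1,f_2,\ldots,f_{n-1})^{\rm T}:\mathcal{U}\to\mathbb{R}^{n-1}$ be a smooth (class $\mathcal{C}^1$) function such that: (i) $\Gamma\subseteq\bigcap_{i=1}^{n-1}\{\mathbf{x}\in\mathcal{U} : f_i(\mathbf{x})=0\}$; (ii) the crossings of all the hypersurfaces $\{f_i(\mathbf{x})=0\}$, $i=1,\ldots,n-1$, are transversal over $\Gamma$, i.e. for every $\mathbf{x}\in\Gamma$ the gradients $\nabla f_1(\mathbf{x}),\ldots,\nabla f_{n-1}(\mathbf{x})$ are linearly independent; (iii) there exists an $(n-1)\times(n-1)$ matrix $\mathbf{k}(\mathbf{x})$ of real functions of class $\mathcal{C}^1$ on $\mathcal{U}$ satisfying $$D\mathbf{f}(\mathbf{x})\,\mathbf{X}(\mathbf{x})=\mathbf{k}(\mathbf{x})\,\mathbf{f}(\mathbf{x})\qquad\text{for all }\mathbf{x}\in\mathcal{U}.$$ Let $\mathbf{v}(t)$ be the $(n-1)\times(n-1)$ fundamental matrix solution of the linear system $$\frac{d\mathbf{v}(t)}{dt}=\mathbf{k}(\gamma(t))\,\mathbf{v}(t),\qquad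 \mathbf{v}(0)=\mathrm{Id}.$$ Then the characteristic multipliers of $\Gamma$ are the eigenvalues of $\mathbf{v}(T)$.
   Context: Let $\phi(t,q)$ denote the flow of $\frac{d\mathbf{x}}{dt}=\mathbf{X}(\mathbf{x})$, that is, the solution with $\phi(0,q)=q$. Here $D\mathbf{f}(\mathbf{x})$ is the $(n-1)\times n$ Jacobian matrix of $\mathbf{f}$. Poincaré map: given $p\in\Gamma$, let $\Sigma$ be a section through $p$, that is, a local smooth manifold of dimension $n-1$ passing through $p$ and transversal to $\Gamma$ (to $\mathbf{X}(p)$) at $p$. The Poincaré map is $\Pi(q)=\phi(\tau(q),q)$, defined for $q\in\Sigma$ near $p$, with values in $\Sigma$, where $\tau$ is the unique real function such that $\phi(\tau(q),q)\in\Sigma$ and $\lim_{q\to p}\tau(q)=T$. In particular $\Pi(p)=p$. Characteristic multipliers: the $n-1$ (complex) eigenvalues, counted with algebraic multiplicity, of the derivative $D\Pi(p)$ (a linear endomorphism of the $(n-1)$-dimensional tangent space $T_p\Sigma$). It is a standard fact that they do not depend on the choice of $p\in\Gamma$ and $\Sigma$; they are called the characteristic multipliers of $\Gamma$. *)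

(* Defs.v *)
(* Points of R^n are column vectors (R : realType); a map with domain U is a total
   function of which only the values on U are ever used. *)
From HB Require Import structures.
From mathcomp Require Import all_boot all_order all_algebra.
From mathcomp Require Import all_classical all_reals all_analysis.
From mathcomp Require Import complex.

Set Implicit Arguments.
Unset Strict Implicit.
Unset Printing Implicit Defensive.

Import Order.TTheory GRing.Theory Num.Theory.
Import numFieldNormedType.Exports.

Local Open Scope classical_set_scope.
Local Open Scope ring_scope.

(* Continuity of the differential is required pointwise in the direction v; for
   finite-dimensional V and W (the only use below) this is continuity of
   x |-> 'd f x in operator norm. *)
Definition C1_on (R : realType) (V W : normedModType R) (U : set V)
    (f : V -> W) : Prop :=
  forall x, U x ->
    differentiable f x /\ forall v, {for x, continuous (fun y => 'd f y v)}.

(* The usual m x n Jacobian matrix, acting on columns (the library's 'J is its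
   transpose, acting on rows). *)
Definition Jac (R : realType) (m n : nat) (f : 'cV[R]_n -> 'cV[R]_m)
    (x : 'cV[R]_n) : 'M[R]_(m, n) :=
  \matrix_(i, j) ('d f x (delta_mx j 0)) i 0.

(* The n complex eigenvalues of a real matrix, listed with their algebraic
   multiplicities, in an unspecified order. *)
Definition eigenvalues (R : realType) (n : nat) (A : 'M[R]_n) : seq R[i] :=
  sval (closed_field_poly_normal (char_poly (map_mx (real_complex R) A))).

Definition solution_on (R : realType) (n : nat) (U : set 'cV[R]_n)
    (X : 'cV[R]_n -> 'cV[R]_n) (I : set R) (x : R -> 'cV[R]_n) : Prop :=
  forall s, I s -> U (x s) /\ is_derive s 1 x (X (x s)).

(* flow_graph U X t q y: the maximal solution starting at q is defined at time t
   and has value y there. *)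
Definition flow_graph (R : realType) (n : nat) (U : set 'cV[R]_n)
    (X : 'cV[R]_n -> 'cV[R]_n) (t : R) (q y : 'cV[R]_n) : Prop :=
  exists (a b : R) (x : R -> 'cV[R]_n),
    [/\ a < 0 < b, a < t < b, solution_on U X `]a, b[ x, x 0 = q & x t = y].

Definition flow_dom (R : realType) (n : nat) (U : set 'cV[R]_n)
    (X : 'cV[R]_n -> 'cV[R]_n) (t : R) (q : 'cV[R]_n) : Prop :=
  exists y, flow_graph U X t q y.

(* phi(t, q); the value is 0 outside flow_dom. *)
Definition flow (R : realType) (n : nat) (U : set 'cV[R]_n)
    (X : 'cV[R]_n -> 'cV[R]_n) (t : R) (q : 'cV[R]_n) : 'cV[R]_n :=
  xget 0 [set y | flow_graph U X t q y].

Definition periodic_solution (R : realType) (n : nat) (U : set 'cV[R]_n)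
    (X : 'cV[R]_n -> 'cV[R]_n) (T : R) (gamma : R -> 'cV[R]_n) : Prop :=
  [/\ solution_on U X setT gamma, forall t, gamma (t + T) = gamma t
    & exists t, gamma t <> gamma 0].

Definition orbit_of (R : realType) (n : nat) (T : R)
    (gamma : R -> 'cV[R]_n) : set 'cV[R]_n := gamma @` `[0, T[.

(* sigma : W -> S is a C^1 embedding of an open subset W of R^d onto a
   neighbourhood of p in S, with inverse chart kappa, so that S is near p an
   embedded C^1 submanifold of dimension d. *)
Definition local_param (R : realType) (d n : nat) (S : set 'cV[R]_n)
    (p : 'cV[R]_n) (W : set 'cV[R]_d) (sigma : 'cV[R]_d -> 'cV[R]_n)
    (kappa : 'cV[R]_n -> 'cV[R]_d) : Prop :=
  [/\ S p,
      open W /\ C1_on W sigma,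
      (forall w, W w -> injective ('d sigma w)),
      (forall w, W w -> kappa (sigma w) = w) /\
        {within sigma @` W, continuous kappa}
    & exists V : set 'cV[R]_n, [/\ open V, V p & S `&` V = sigma @` W]].

Definition tangent_space (R : realType) (d n : nat) (p : 'cV[R]_n)
    (sigma : 'cV[R]_d -> 'cV[R]_n) (kappa : 'cV[R]_n -> 'cV[R]_d) :
    set 'cV[R]_n :=
  range ('d sigma (kappa p)).

(* S, with the chart (W, sigma, kappa) at p, is a hypersurface through p
   transversal to X p. *)
Definition section_at (R : realType) (n : nat) (X : 'cV[R]_n -> 'cV[R]_n)
    (S : set 'cV[R]_n) (p : 'cV[R]_n) (W : set 'cV[R]_n.-1)
    (sigma : 'cV[R]_n.-1 -> 'cV[R]_n) (kappa : 'cV[R]_n -> 'cV[R]_n.-1) :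
    Prop :=
  local_param S p W sigma kappa /\ ~ tangent_space p sigma kappa (X p).

Definition return_time (R : realType) (n : nat) (U : set 'cV[R]_n)
    (X : 'cV[R]_n -> 'cV[R]_n) (T : R) (S : set 'cV[R]_n) (p : 'cV[R]_n)
    (tau : 'cV[R]_n -> R) : Prop :=
  (\forall q \near within S (nbhs p),
     flow_dom U X (tau q) q /\ S (flow U X (tau q) q)) /\
  tau q @[q --> within S (nbhs p)] --> T.

Definition poincare_map (R : realType) (n : nat) (U : set 'cV[R]_n)
    (X : 'cV[R]_n -> 'cV[R]_n) (tau : 'cV[R]_n -> R) (q : 'cV[R]_n) :
    'cV[R]_n :=
  flow U X (tau q) q.

(* Expression in the chart (sigma, kappa) of a map F from S to S. *)
Definition in_chart (R : realType) (d n : nat) (sigma : 'cV[R]_d -> 'cV[R]_n)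
    (kappa : 'cV[R]_n -> 'cV[R]_d) (F : 'cV[R]_n -> 'cV[R]_n) :
    'cV[R]_d -> 'cV[R]_d :=
  kappa \o F \o sigma.

(* s is the list, with multiplicities, of the eigenvalues of D Pi(p), for every
   point p of the orbit, section S through p, chart of S at p, and return time.
   The endomorphism D Pi(p) of T_p S is represented by its matrix in the basis
   of T_p S given by the chart, i.e. the Jacobian matrix at kappa p of
   kappa o Pi o sigma; its existence is part of the assertion. *)
Definition characteristic_multipliers (R : realType) (n : nat)
    (U : set 'cV[R]_n) (X : 'cV[R]_n -> 'cV[R]_n) (T : R)
    (gamma : R -> 'cV[R]_n) (s : seq R[i]) : Prop :=
  forall (p : 'cV[R]_n) (S : set 'cV[R]_n) (W : set 'cV[R]_n.-1)
    (sigma : 'cV[R]_n.-1 -> 'cV[R]_n) (kappa : 'cV[R]_n -> 'cV[R]_n.-1)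
    (tau : 'cV[R]_n -> R),
    orbit_of T gamma p ->
    section_at X S p W sigma kappa ->
    return_time U X T S p tau ->
    let P := in_chart sigma kappa (poincare_map U X tau) in
    differentiable P (kappa p) /\ perm_eq (eigenvalues (Jac P (kappa p))) s.

(* Main.v *)
(** Along a solution [x] of the differential system, [z = f \o x] solves the
    linear equation [z' = k(x) z]. Hence, for [q] on the section near [p],
    [f (Pi q) = M (f q) + o(|f q|)], where [M] is the transition matrix of
    [z' = k(gamma) z] over one period starting at [p]; two Gronwall estimates
    replace the theory of differentiability of the flow, since they give the
    continuity of the flow at [p] and the comparison of transition matrices.
    By transversality [f] restricted to the section has an invertible derivative
    [A] at [p], so that the continuous map [Pi] is differentiable at [p], with
    derivative [A^-1 M A]. Finally [M = v(t0) v(T) v(t0)^-1] if [p = gamma(t0)],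
    because [v(t + T) = v(t) v(T)]. *)
Require Import Defs.
From mathcomp Require Import all_boot all_order all_algebra.
From mathcomp Require Import all_classical all_reals all_analysis.
From mathcomp Require Import complex lra ring.
Import Order.TTheory GRing.Theory Num.Theory.
Import numFieldNormedType.Exports.
Local Open Scope classical_set_scope.
Local Open Scope ring_scope.

Set Implicit Arguments.
Unset Strict Implicit.
Unset Printing Implicit Defensive.

(** * Sup norm of matrices and calculus of matrix-valued curves *)

Lemma ler_entry_norm (R : realType) (m n : nat) (M : 'M[R]_(m, n)) i j :
  `|M i j| <= `|M|.
Proof.
by rewrite [leRHS]/Num.Def.normr/= mx_normrE; exact: (le_bigmax _ _ (i, j)).
Qed.

Lemma ler_norm_entries (R : realType) (m n : nat) (M : 'M[R]_(m, n)) (c : R) :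
  0 <= c -> (forall i j, `|M i j| <= c) -> `|M| <= c.
Proof.
move=> c0 Mc; rewrite [leLHS]/Num.Def.normr/= mx_normrE.
by apply: bigmax_le => // -[i j] _; exact: Mc.
Qed.

Lemma ler_norm_mulmx (R : realType) (m n p : nat)
    (A : 'M[R]_(m, n)) (B : 'M[R]_(n, p)) :
  `|A *m B| <= n%:R * (`|A| * `|B|).
Proof.
apply: ler_norm_entries => [|i j]; first by rewrite !mulr_ge0.
rewrite mxE (le_trans (ler_norm_sum _ _ _))//.
apply: (@le_trans _ _ (\sum_(l < n) `|A| * `|B|)).
  by apply: ler_sum => l _; rewrite normrM ler_pM// ler_entry_norm.
by rewrite sumr_const card_ord mulr_natl.
Qed.

Lemma continuous_at_sum (R : realType) (T : topologicalType)
    (W : normedModType R) p (F : 'I_p -> T -> W) (x : T) :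
  (forall i, {for x, continuous (F i)}) ->
  {for x, continuous (fun y => \sum_(i < p) F i y)}.
Proof.
elim: p F => [|p IH] F Fc.
  have -> : (fun y => \sum_(i < 0) F i y) = cst 0.
    by apply/funext => y; rewrite big_ord0.
  exact: cvg_cst.
have -> : (fun y => \sum_(i < p.+1) F i y) =
    fun y => \sum_(i < p) F (widen_ord (leqnSn p) i) y + F ord_max y.
  by apply/funext => y; rewrite big_ord_recr.
by apply: cvgD; [apply: IH => i; exact: Fc|exact: Fc].
Qed.

Lemma continuous_linear_mx (R : realType) (m n : nat) (W : normedModType R)
    (L : {linear 'M[R]_(m, n) -> W}) : continuous L.
Proof.
have -> : (L : 'M[R]_(m, n) -> W) = fun M =>
    \sum_(i < m) \sum_(j < n) M i j *: L (delta_mx i j).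
  apply/funext => M; rewrite {1}(matrix_sum_delta M) linear_sum.
  apply: eq_bigr => i _; rewrite linear_sum.
  by apply: eq_bigr => j _; rewrite linearZ.
move=> M; apply: continuous_at_sum => i; apply: continuous_at_sum => j.
exact: (cvgZr_tmp (@coord_continuous R m n i j M)).
Qed.

Lemma is_derive_linear (R : realType) (m n : nat) (W : normedModType R)
    (L : {linear 'M[R]_(m, n) -> W}) (y : R -> 'M[R]_(m, n)) (t : R) dy :
  is_derive t 1 y dy -> is_derive t 1 (fun s => L (y s)) (L dy).
Proof.
move=> ydy.
have dfy : differentiable y t by apply/derivable1_diffP; exact: ex_derive.
have Lc : continuous L by exact: continuous_linear_mx.
have dL : differentiable L (y t) by exact: linear_differentiable.
have dLy : differentiable (L \o y) t by exact: differentiable_comp.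
apply: DeriveDef; first exact/diff_derivable.
rewrite deriveE// diff_comp//= diff_lin//.
by rewrite -deriveE// derive_val.
Qed.

Lemma is_derive_entry (R : realType) (m n : nat) (y : R -> 'M[R]_(m, n))
    (t : R) dy i j :
  is_derive t 1 y dy -> is_derive t 1 (fun s => y s i j) (dy i j).
Proof.
move=> ydy; apply: DeriveDef.
  by move: i j; apply/derivable_mxP; exact: ex_derive.
by rewrite -(@derive_val _ _ _ _ _ _ _ ydy) derive_mx ?mxE.
Qed.

Lemma is_derive_continuous (R : realType) (W : normedModType R) (y : R -> W)
    (t : R) dy : is_derive t 1 y dy -> {for t, continuous y}.
Proof.
by move=> ydy; apply/differentiable_continuous/derivable1_diffP; exact: ex_derive.
Qed.

(** Serves for time shifts ([c = 1]), for time reversal ([c = -1]) and for exponential weights.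
    Curves below are written in the literal form [c * s + a] so that it applies. *)
Lemma is_derive_comp_affine (R : realType) (W : normedModType R) (y : R -> W)
    (a c t : R) dy :
  is_derive (c * t + a) 1 y dy ->
  is_derive t 1 (fun s => y (c * s + a)) (c *: dy).
Proof.
move=> ydy.
have h' : is_derive t 1 (fun s : R => c * s + a) c.
  rewrite (_ : (fun s => _) = (c \*: (@id R)) + cst a)//.
  by apply: is_derive_eq; rewrite addr0 /GRing.scale/= mulr1.
have dh : differentiable (fun s : R => c * s + a) t.
  by apply/derivable1_diffP; exact: ex_derive.
have dy' : differentiable y (c * t + a).
  by apply/derivable1_diffP; exact: ex_derive.
have dyh : differentiable (y \o (fun s : R => c * s + a)) t.
  exact: differentiable_comp.
apply: DeriveDef; first exact/diff_derivable.
rewrite deriveE// diff_comp//= -(deriveE _ dh) derive_val.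
rewrite -[X in 'd _ _ X]mulr1 -[X in 'd _ _ X]/(c *: 1) linearZ/=.
by rewrite -(deriveE _ dy') derive_val.
Qed.

(** * Gronwall inequalities *)

(** The product of [E] with the weight exp(-C t) has nonpositive derivative, hence does not increase
    from [a] to [b]. *)
Lemma gronwall_scalar (R : realType) (E dE : R -> R) (a b C : R) :
  a <= b -> {within `[a, b], continuous E} ->
  (forall t, t \in `]a, b[ -> is_derive t 1 E (dE t)) ->
  (forall t, t \in `]a, b[ -> dE t <= C * E t) ->
  E b <= E a * expR (C * (b - a)).
Proof.
move=> ab Ec Ed EC.
pose w (t : R) : R := expR (- C * t + 0).
pose G (t : R) : R := E t * w t.
have wd (t : R) : is_derive t 1 w (- C *: w t) by apply: is_derive_comp_affine.
have Gd (t : R) : t \in `]a, b[ -> is_derive t 1 G (E t * (- C * w t) + w t * dE t).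
  by move=> /Ed Et; apply: (@is_deriveM _ _ E w).
have wc : {within `[a, b], continuous w}.
  by apply: continuous_subspaceT => t; exact: is_derive_continuous.
have Gc : {within `[a, b], continuous G} by move=> t; apply: cvgM; [exact: Ec|exact: wc].
have : G b <= G a.
  apply: (@ler0_derive1_le_cc _ G a b) => //.
  - by move=> t tab; have := Gd t tab => ?; exact: ex_derive.
  - move=> t tab; have := Gd t tab => ?; rewrite derive1E derive_val.
    have := EC t tab; have : 0 < w t by exact: expR_gt0.
    move=> w0 h; nra.
  - by rewrite in_itv/= lexx ab.
  - by rewrite in_itv/= lexx ab.
rewrite /G /w -ler_pdivlMr ?expR_gt0// => /le_trans; apply.
rewrite -mulrA -expRB le_eqVlt; apply/orP; left; apply/eqP.
by congr (_ * expR _); ring.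
Qed.

(** The exponent is the growth rate of the sum of squares plus e^2. The factor [m.+1] comes from
    bounding that quantity by the sup norm: [m] for the squares and 1 for e^2. *)
Definition gronwall_const (R : realType) (m : nat) (L d : R) : R :=
  m.+1%:R * expR (m%:R * (2 * L + 1) * d).

Lemma gronwall_const_ge1 (R : realType) m (L d : R) :
  0 <= L -> 0 <= d -> 1 <= gronwall_const m L d.
Proof.
move=> L0 d0; rewrite /gronwall_const -[leLHS]mulr1.
rewrite ler_pM ?ler1n// (le_trans _ (expR_ge1Dx _))// lerDl.
by rewrite !mulr_ge0// addr_ge0// mulr_ge0.
Qed.

Lemma gronwall_const_le (R : realType) m (L d d' : R) :
  0 <= L -> d <= d' -> gronwall_const m L d <= gronwall_const m L d'.
Proof.
move=> L0 dd'; rewrite /gronwall_const ler_wpM2l// ler_expR ler_wpM2l//.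
by rewrite mulr_ge0// addr_ge0// mulr_ge0.
Qed.

Lemma ler_norm_sqrt_sum (R : realType) m (y : 'cV[R]_m) :
  `|y| <= Num.sqrt (\sum_(i < m) y i 0 ^+ 2).
Proof.
apply: ler_norm_entries => [|i j]; first exact: sqrtr_ge0.
rewrite -sqrtr_sqr ler_sqrt; last by apply: sumr_ge0 => l _; exact: sqr_ge0.
rewrite ord1 (bigD1 i)//= lerDl.
by apply: sumr_ge0 => l _; exact: sqr_ge0.
Qed.

Lemma within_continuous_entry (R : realType) (T : topologicalType) (A : set T)
    (m n : nat) (y : T -> 'M[R]_(m, n)) i j :
  {within A, continuous y} -> {within A, continuous (fun t => y t i j)}.
Proof.
move=> yc t.
apply: (@continuous_comp (subspace A) 'M[R]_(m, n) R y (fun M => M i j) t).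
  exact: yc.
exact: coord_continuous.
Qed.

(* The sum of squares [E] satisfies [(E + e^2)' <= m (2 L + 1) (E + e^2)], and
   [E] is within a factor [m] of the square of the sup norm. *)
Lemma gronwall (R : realType) (m : nat) (y dy : R -> 'cV[R]_m) (a b L e : R) :
  a <= b -> 0 <= L -> 0 <= e ->
  {within `[a, b], continuous y} ->
  (forall t, t \in `]a, b[ -> is_derive t 1 y (dy t)) ->
  (forall t, t \in `]a, b[ -> `|dy t| <= L * `|y t| + e) ->
  `|y b| <= gronwall_const m L (b - a) * (`|y a| + e).
Proof.
move=> ab L0 e0 yc yd ydy.
pose E t := \sum_(i < m) y t i 0 ^+ 2 + e ^+ 2.
pose dE t := \sum_(i < m) (y t i 0 * dy t i 0 + y t i 0 * dy t i 0).
have Ec : {within `[a, b], continuous E}.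
  move=> t; apply: cvgD; last exact: cvg_cst.
  apply: (@continuous_at_sum R (subspace `[a, b]) R) => i.
  by apply: cvgM; exact: (within_continuous_entry yc).
have Ed (t : R) : t \in `]a, b[ -> is_derive t 1 E (dE t).
  move=> /yd ytd; rewrite -[dE t]addr0.
  have -> : E = \sum_(i < m) ((fun s => y s i 0) * (fun s => y s i 0)) + cst (e ^+ 2).
    by apply/funext => s; rewrite /E /= !fctE fct_sumE.
  apply: is_deriveD; apply: is_derive_sum => i.
  by apply: is_deriveM; apply: is_derive_entry.
have yE t : `|y t| ^+ 2 <= E t - e ^+ 2.
  rewrite /E addrK.
  have h0 : 0 <= \sum_(i < m) y t i 0 ^+ 2 by apply: sumr_ge0 => ? _; exact: sqr_ge0.
  by rewrite -[leRHS]sqr_sqrtr// lerXn2r ?nnegrE ?sqrtr_ge0// ler_norm_sqrt_sum.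
have dEE t : t \in `]a, b[ -> dE t <= m%:R * (2 * L + 1) * E t.
  move=> tab; apply: (@le_trans _ _ (\sum_(i < m) (2 * (`|y t| * `|dy t|)))).
    apply: ler_sum => i _.
    have : y t i 0 * dy t i 0 <= `|y t| * `|dy t|.
      by rewrite (le_trans (ler_norm _))// normrM ler_pM// ler_entry_norm.
    lra.
  rewrite sumr_const card_ord -[leLHS]mulr_natl -mulrA ler_wpM2l//.
  (* The cross term 2 e |y| is at most |y|^2 + e^2, which explains the 1 in 2 L + 1; the e^2 is
     absorbed by the one contained in [E]. *)
  have h1 := ydy t tab; have h2 := yE t; have h3 : 0 <= `|y t| by [].
  have h4 : 0 <= (`|y t| - e) ^+ 2 by exact: sqr_ge0.
  have h5 : `|y t| * `|dy t| <= `|y t| * (L * `|y t| + e) by rewrite ler_wpM2l.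
  have h6 : L * `|y t| ^+ 2 <= L * (E t - e ^+ 2) by rewrite ler_wpM2l.
  have h7 : 0 <= L * e ^+ 2 by rewrite mulr_ge0// sqr_ge0.
  nra.
have := gronwall_scalar ab Ec Ed dEE.
set k := expR _ => Eb.
have k1 : 1 <= k.
  rewrite (le_trans _ (expR_ge1Dx _))// lerDl.
  by rewrite !mulr_ge0// ?subr_ge0// addr_ge0// mulr_ge0.
rewrite /gronwall_const -/k.
set c := _ * k * _.
have c0 : 0 <= c by rewrite !mulr_ge0// ?addr_ge0// (le_trans _ k1).
rewrite -ler_sqr ?nnegrE//; apply: le_trans (yE b) _.
apply: (@le_trans _ _ (E b)); first by rewrite gerBl sqr_ge0.
apply: le_trans Eb _.
have Ea : E a <= m.+1%:R * (`|y a| + e) ^+ 2.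
  rewrite /E -[m.+1]addn1 natrD mulrDl mul1r lerD//; last first.
    by rewrite lerXn2r ?nnegrE// ?addr_ge0// lerDr.
  apply: (@le_trans _ _ (\sum_(i < m) (`|y a| + e) ^+ 2)); last first.
    by rewrite sumr_const card_ord mulr_natl.
  apply: ler_sum => i _; rewrite -[leLHS]real_normK ?num_real//.
  by rewrite lerXn2r ?nnegrE ?addr_ge0// (le_trans (ler_entry_norm _ i 0))// lerDl.
rewrite /c !exprMn.
(* Both constants are at least 1, hence at most their squares, so the bound on squares yields one on
   norms without square roots of constants. *)
have h8 : m.+1%:R <= m.+1%:R ^+ 2 :> R by rewrite ler_eXnr// ler1n.
have h9 : k <= k ^+ 2 by rewrite ler_eXnr.
have k0 : 0 <= k by rewrite (le_trans _ k1).
apply: (@le_trans _ _ ((m.+1%:R * (`|y a| + e) ^+ 2) * k)).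
  by rewrite ler_wpM2r.
by rewrite [leLHS]mulrAC ler_wpM2r ?sqr_ge0// ler_pM.
Qed.

(** * Uniqueness for linear differential equations *)

Lemma continuous_norm_bounded (R : realType) (V : normedModType R)
    (B : R -> V) (a b : R) :
  (forall t : R, {for t, continuous B}) ->
  exists2 M, 0 <= M & forall t, t \in `[a, b] -> `|B t| <= M.
Proof.
move=> Bc.
have : compact (B @` `[a, b]).
  by apply: continuous_compact; [exact: continuous_subspaceT|exact: segment_compact].
move=> /compact_bounded[M [_ MB]]; exists (`|M| + 1) => [|t tab].
  by rewrite addr_ge0.
apply: MB; first by rewrite (le_lt_trans (ler_norm _))// ltrDl.
by exists t.
Qed.

(** Gronwall with [e = 0], since [B] is bounded on the compact segment. *)
Lemma linear_ode_eq0 (R : realType) (m : nat) (B : R -> 'M[R]_m)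
    (y : R -> 'cV[R]_m) (a b : R) :
  (forall t : R, {for t, continuous B}) ->
  (forall t : R, is_derive t 1 y (B t *m y t)) ->
  a <= b -> y a = 0 -> y b = 0.
Proof.
move=> Bc yd ab ya.
have [M M0 BM] := @continuous_norm_bounded _ _ B a b Bc.
apply/eqP; rewrite -normr_le0.
have := @gronwall R m y (fun t => B t *m y t) a b (m%:R * M) 0 ab.
rewrite mulr_ge0// ya normr0 addr0 mulr0; apply => //.
- by apply: continuous_subspaceT => t; exact: is_derive_continuous.
- move=> t tab; rewrite addr0 (le_trans (ler_norm_mulmx _ _))// -mulrA.
  rewrite ler_wpM2l// ler_wpM2r// BM//.
  by move: tab; exact: subset_itv_oo_cc.
Qed.

(** Time reversal: y(-t) solves the equation with matrix -B(-t), to which the forward statement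
    applies. *)
Lemma linear_ode_eq0_rev (R : realType) (m : nat) (B : R -> 'M[R]_m)
    (y : R -> 'cV[R]_m) (a b : R) :
  (forall t : R, {for t, continuous B}) ->
  (forall t : R, is_derive t 1 y (B t *m y t)) ->
  a <= b -> y b = 0 -> y a = 0.
Proof.
move=> Bc yd ab yb.
pose z t := y (- 1 * t + 0).
have zE t : z t = y (- t) by rewrite /z mulN1r addr0.
have -> : y a = z (- a) by rewrite zE opprK.
apply: (@linear_ode_eq0 _ _ (fun t => - B (- t)) z (- b)).
- move=> t; apply: cvgN; apply: (@cvg_comp _ _ _ (fun t => - t) B _ (nbhs (- t))).
    exact: opp_continuous.
  exact: Bc.
- move=> t; have := @is_derive_comp_affine _ _ y 0 (-1) t _ (yd (- 1 * t + 0)).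
  by rewrite scaleN1r mulN1r addr0 -zE mulNmx.
- by rewrite lerN2.
- by rewrite zE opprK.
Qed.

(** * Lipschitz bounds and uniformity along a compact arc *)

Lemma is_derive_comp_diff (R : realType) (V W : normedModType R)
    (f : V -> W) (x : R -> V) (t : R) dx :
  is_derive t 1 x dx -> differentiable f (x t) ->
  is_derive t 1 (fun s => f (x s)) ('d f (x t) dx).
Proof.
move=> xdx df.
have dfx : differentiable x t by apply/derivable1_diffP; exact: ex_derive.
have dfc : differentiable (f \o x) t by exact: differentiable_comp.
apply: DeriveDef; first exact/diff_derivable.
by rewrite deriveE// diff_comp//= -(deriveE _ dfx) derive_val.
Qed.

(** [C1_on] controls the differential one direction at a time; bounds on the finitely many basis
    vectors add up to an operator bound. *)
Lemma ler_norm_linear_cV (R : realType) (n : nat) (W : normedModType R)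
    (L : {linear 'cV[R]_n -> W}) (c : 'I_n -> R) (u : 'cV[R]_n) :
  (forall j, `|L (delta_mx j 0)| <= c j) -> `|L u| <= (\sum_j c j) * `|u|.
Proof.
move=> Lc; rewrite {1}[u]matrix_sum_delta linear_sum.
rewrite mulr_suml (le_trans (ler_norm_sum _ _ _))// ler_sum// => j _.
by rewrite big_ord1 linearZ normrZ mulrC ler_pM// ler_entry_norm.
Qed.

(** The differential is bounded on a ball around [x]. The ball is convex, so the mean value theorem
    applies to each coordinate of [f] along the segment from [z] to [y]. *)
Lemma C1_locally_lipschitz (R : realType) (m n : nat) (U : set 'cV[R]_n)
    (f : 'cV[R]_n -> 'cV[R]_m) (x : 'cV[R]_n) :
  open U -> C1_on U f -> U x ->
  exists L r : R, [/\ 0 < L, 0 < r & forall y z, `|y - x| < r -> `|z - x| < r ->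
    `|f y - f z| <= L * `|y - z|].
Proof.
move=> Uo fC1 Ux.
have : \forall y \near x, U y /\ forall j : 'I_n,
    `|'d f y (delta_mx j 0)| <= `|'d f x (delta_mx j 0)| + 1.
  apply: filterI; first by move: Uo; rewrite openE; exact.
  apply: (@filter_forall _ _ (fun j (y : 'cV[R]_n) =>
    `|'d f y (delta_mx j 0)| <= `|'d f x (delta_mx j 0)| + 1) (nbhs x)) => j.
  have := (fC1 x Ux).2 (delta_mx j 0) => /cvgrPdist_le/(_ 1 ltr01).
  apply: filterS => y h; rewrite -lerBlDl.
  by apply: le_trans (lerB_dist _ _) _; rewrite distrC.
move=> /nbhs_ballP[r /= r0 rP].
pose L := \sum_(j < n) (`|'d f x (delta_mx j 0)| + 1) + 1.
have L0 : 0 < L.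
  by rewrite /L ltr_pwDr// sumr_ge0// => j _; rewrite addr_ge0.
have inball y : `|y - x| < r -> ball x r y by rewrite -ball_normE/= distrC.
have rU y : `|y - x| < r -> U y by move=> /inball/rP[].
have dL y u : `|y - x| < r -> `|'d f y u| <= L * `|u|.
  move=> /inball/rP[_ yP]; apply: le_trans (ler_norm_linear_cV _ yP) _.
  by rewrite ler_wpM2r// lerDl.
clearbody L; clear rP; exists L, r; split=> // y z yx zx.
apply: ler_norm_entries => [|i j]; first by rewrite mulr_ge0// ltW.
rewrite ord1 {j} !mxE.
pose p (s : R) := s *: (y - z) + z.
have px s : s \in `[0, 1] -> `|p s - x| < r.
  rewrite in_itv/= => /andP[s0 s1].
  have -> : p s - x = s *: (y - x) + (1 - s) *: (z - x).
    by apply/matrixP => a b; rewrite !mxE; ring.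
  rewrite (le_lt_trans (ler_normD _ _))// !normrZ !ger0_norm ?subr_ge0//.
  apply: (@le_lt_trans _ _ (Num.max `|y - x| `|z - x|)); last by rewrite gt_max yx.
  have h1 : `|y - x| <= Num.max `|y - x| `|z - x| by rewrite le_max lexx.
  have h2 : `|z - x| <= Num.max `|y - x| `|z - x| by rewrite le_max lexx orbT.
  by nra.
have pd (s : R) : is_derive s 1 p (y - z).
  have : is_derive s 1 ( *:%R^~ (y - z) : R -> _) (y - z).
    by apply: DeriveDef; [exact/diff_derivable|rewrite deriveE// diff_val scale1r].
  move=> sd; rewrite (_ : p = ( *:%R^~ (y - z)) + cst z)//.
  by apply: is_derive_eq; exact: addr0.
have gd (s : R) : s \in `[0, 1] ->
    is_derive s 1 (fun s => f (p s) i 0) ('d f (p s) (y - z) i 0).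
  move=> s01; apply: is_derive_entry; apply: is_derive_comp_diff => //.
  by have [] := fC1 (p s) (rU _ (px s s01)).
have gc : {within `[0, 1], continuous (fun s => f (p s) i 0)}.
  apply: derivable_within_continuous => s s01.
  by have := gd s s01 => ?; exact: ex_derive.
have [s s01] := MVT ltr01 (fun s h => gd s (subset_itv_oo_cc h)) gc.
rewrite subr0 mulr1 /p scale1r scale0r subrK add0r => ->.
apply: le_trans (ler_entry_norm _ _ _) _.
exact/dL/px/subset_itv_oo_cc.
Qed.

(** Compactness of the segment in its filter form, with the radius as a parameter tending to 0 from
    the right. [P] is not assumed monotone in the radius, so the hypothesis speaks of all small
    radii. *)
Lemma segment_uniform_radius (R : realType) (P : R -> R -> Prop) (a b : R) :
  (forall t, t \in `[a, b] -> exists2 r : R, 0 < r &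
     forall s, `|s - t| < r -> forall i, 0 < i < r -> P i s) ->
  exists2 r : R, 0 < r & forall t, t \in `[a, b] -> P r t.
Proof.
move=> locP.
have /compact_near_coveringP cover := @segment_compact R a b.
have /(cover R (0%R^'+) P _) : forall t, `[a, b]%classic t ->
    \forall s \near t & i \near 0%R^'+, P i s.
  move=> t tab; have [r r0 rP] := locP t tab.
  exists (ball t r, [set i : R | 0 < i < r]) => /=.
    split; first exact: nbhsx_ballx.
    near=> i; apply/andP; split.
      by near: i; exact: nbhs_right_gt.
    by near: i; exact: nbhs_right_lt.
  by move=> [s i]/= []; rewrite -ball_normE/= distrC => /rP; exact.
move=> nearP.
have : \forall i \near 0%R^'+, 0 < i /\ `[a, b] `<=` P i.
  apply: filterI; last exact: nearP.
  exact: nbhs_right_gt.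
by move=> /filter_ex[r [r0 rP]]; exists r.
Unshelve. all: by end_near. Qed.

Lemma uniform_cvg_along_curve (R : realType) (V W : normedModType R)
    (k : V -> W) (y : R -> V) (a b e : R) :
  0 < e -> (forall t : R, {for t, continuous y}) ->
  (forall t, {for y t, continuous k}) ->
  exists2 r : R, 0 < r & forall t, t \in `[a, b] ->
    forall z, `|z - y t| < r -> `|k z - k (y t)| <= e.
Proof.
move=> e0 yc kc; pose P r t := forall z, `|z - y t| < r -> `|k z - k (y t)| <= e.
apply: (@segment_uniform_radius _ P) => t _.
have e2 : 0 < e / 2 by rewrite divr_gt0.
have /cvgrPdist_le/(_ _ e2)/nbhs_ballP[r /= r0 rk] := kc t.
have r2 : 0 < r / 2 by rewrite divr_gt0.
have /cvgrPdist_lt/(_ _ r2)/nbhs_ballP[r' /= r'0 ry] := yc t.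
(* Half of [r] is spent on moving from [y t] to [y s] and half on moving from [y s] to [z]. *)
exists (Num.min r' (r / 2)); first by rewrite lt_min r'0 r2.
move=> s; rewrite lt_min => /andP[sr' _] i; rewrite lt_min => /and3P[i0 _ ir] z zi.
have ys : `|y t - y s| < r / 2 by apply: ry; rewrite -ball_normE/= distrC.
have kz : `|k (y t) - k z| <= e / 2.
  apply: rk; rewrite -ball_normE/= -(subrKA (y s)) (le_lt_trans (ler_normD _ _))//.
  by rewrite [ltRHS]splitr ltrD// distrC (lt_trans zi).
have ks : `|k (y t) - k (y s)| <= e / 2.
  apply: rk; rewrite -ball_normE/= (lt_trans ys)//.
  by rewrite ltr_pdivrMr// ltr_pMr// ltr1n.
rewrite -(subrKA (k (y t))) (le_trans (ler_normD _ _))// [leRHS]splitr lerD//.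
by rewrite distrC.
Qed.

Lemma lipschitz_along_curve (R : realType) (m n : nat) (U : set 'cV[R]_n)
    (X : 'cV[R]_n -> 'cV[R]_m) (y : R -> 'cV[R]_n) (a b : R) :
  open U -> C1_on U X -> (forall t : R, {for t, continuous y}) ->
  (forall t, U (y t)) ->
  exists L r : R, [/\ 0 < L, 0 < r & forall t, t \in `[a, b] ->
    forall z, `|z - y t| < r -> `|X z - X (y t)| <= L * `|z - y t|].
Proof.
move=> Uo XC1 yc Uy.
(* A single parameter is both the radius and the inverse of the Lipschitz constant: decreasing it
   weakens both demands. *)
pose P r t := forall z, `|z - y t| < r -> `|X z - X (y t)| <= r^-1 * `|z - y t|.
have [|r r0 rP] := @segment_uniform_radius _ P a b; last first.
  by exists r^-1, r; split; rewrite ?invr_gt0.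
move=> t _; have [L [r [L0 r0 XL]]] := C1_locally_lipschitz Uo XC1 (Uy t).
have r2 : 0 < r / 2 by rewrite divr_gt0.
have /cvgrPdist_lt/(_ _ r2)/nbhs_ballP[r' /= r'0 ry] := yc t.
exists (Num.min r' (Num.min (r / 2) L^-1)).
  by rewrite !lt_min r'0 r2 invr_gt0.
move=> s; rewrite lt_min => /andP[sr' _] i.
rewrite !lt_min => /andP[i0 /and3P[_ ir iL]] z zi.
have ys : `|y t - y s| < r / 2 by apply: ry; rewrite -ball_normE/= distrC.
have syr : `|y s - y t| < r.
  by rewrite distrC (lt_trans ys)// ltr_pdivrMr// ltr_pMr// ltr1n.
have zyr : `|z - y t| < r.
  rewrite -(subrKA (y s)) (le_lt_trans (ler_normD _ _))//.
  by rewrite [ltRHS]splitr ltrD ?(lt_trans zi)// distrC.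
have := XL z (y s) zyr syr.
move=> /le_trans; apply; rewrite ler_wpM2r// -[L]invrK lef_pV2 ?posrE ?invr_gt0//.
exact: ltW.
Qed.

(** * Comparison with a reference solution *)

(** Continuous induction: at the infimum of the bad times all earlier times are good, so [step]
    applies there, and continuity keeps [h] below [r] a little longer, a contradiction. At time 0
    the premise of [step] is vacuous, so [step] contains the initial condition. *)
Lemma first_exit (R : realType) (h : R -> R) (d r : R) :
  (forall t, t \in `[0, d] -> {for t, continuous h}) ->
  (forall t, t \in `[0, d] -> (forall s, s \in `[0, t[ -> h s < r) -> h t < r) ->
  forall t, t \in `[0, d] -> h t < r.
Proof.
move=> hc step t; rewrite in_itv/= => /andP[t0 td]; rewrite ltNge; apply/negP => rt.
pose A : set R := [set s | 0 <= s <= d /\ r <= h s].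
have At : A t by split => //; rewrite t0.
have A0 : lbound A 0 by move=> s [/andP[]].
have Ai : has_inf A by split; [exists t|exists 0].
pose c := inf A.
have c0 : 0 <= c by apply: lb_le_inf => //; exists t.
have cA s : A s -> c <= s by apply: ge_inf; exists 0.
have cd : c \in `[0, d] by rewrite in_itv/= c0 (le_trans (cA _ At)).
have hcr : h c < r.
  apply: step => // s; rewrite in_itv/= => /andP[s0 sc]; rewrite ltNge.
  apply/negP => rs; have := sc; rewrite ltNge => /negP; apply; apply: cA.
  split => //; rewrite s0/=; move: cd; rewrite in_itv/= => /andP[_].
  exact/le_trans/ltW.
have rc : 0 < r - h c by rewrite subr_gt0.
have /cvgrPdist_lt/(_ _ rc)/nbhs_ballP[e /= e0 eP] := hc c cd.
have [s As sc] := inf_adherent e0 Ai.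
have : h s < r.
  have : `|h c - h s| < r - h c.
    apply: eP; rewrite -ball_normE/= distrC ger0_norm ?subr_ge0 ?cA//.
    by rewrite ltrBlDl.
  by rewrite ltr_norml => /andP[+ _]; rewrite ltrBDl; lra.
by case: As => _; rewrite leNgt => /negP.
Qed.

(** The Lipschitz bound is available only while [x] stays in a tube around [y]. As long as it does,
    Gronwall keeps [x] strictly inside a tube that is no wider, and [first_exit] closes the
    argument. *)
Lemma flow_near_solution (R : realType) (n : nat) (U : set 'cV[R]_n)
    (X : 'cV[R]_n -> 'cV[R]_n) (y : R -> 'cV[R]_n) (d : R) :
  open U -> C1_on U X -> solution_on U X setT y -> 0 <= d ->
  forall e : R, 0 < e -> exists2 r, 0 < r & forall x t,
    t \in `[0, d] -> solution_on U X `[0, t] x -> `|x 0 - y 0| < r ->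
    `|x t - y t| < e.
Proof.
move=> Uo XC1 soly d0 e e0.
have yc (t : R) : {for t, continuous y}.
  by have [_] := soly t I; exact: is_derive_continuous.
have Uy t : U (y t) by have [] := soly t I.
have [L [r [L0 r0 Lr]]] := lipschitz_along_curve 0 d Uo XC1 yc Uy.
pose K := gronwall_const n L d.
have K1 : 1 <= K by apply: gronwall_const_ge1 => //; exact: ltW.
have K0 : 0 < K by rewrite (lt_le_trans _ K1).
(* [r] is the radius of the Lipschitz tube and [e] the required precision; the initial gap is
   divided by [K] because Gronwall multiplies it by at most [K]. *)
pose s := Num.min r e.
exists (s / K); first by rewrite divr_gt0// lt_min r0.
move=> x t td solx; rewrite ltr_pdivlMr// => x0.
have t0 : 0 <= t by move: td; rewrite in_itv/= => /andP[].
suff : `|x t - y t| < s by rewrite lt_min => /andP[].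
have xyd u : u \in `[0, t] ->
    is_derive u 1 (x - y) (X (x u) - X (y u)).
  move=> ut; have [_ xu] := solx u ut; have [_ yu] := soly u I.
  exact: is_deriveB.
have xyc (u : R) : u \in `[0, t] -> {for u, continuous (x - y)}.
  by move=> /xyd; exact: is_derive_continuous.
apply: (@first_exit R (fun u => `|x u - y u|) t s) => [u ut|u ut small|]; last first.
- by rewrite in_itv/= t0 lexx.
-
- move: ut; rewrite in_itv/= => /andP[u0 ut].
  have sub v : v \in `[0, u] -> v \in `[0, t].
    by apply: subitvPr; rewrite bnd_simp.
  have zc : {within `[0, u], continuous (x - y)}.
    by apply: continuous_in_subspaceT => v; rewrite inE/= => /sub; exact: xyc.
  have zd (v : R) : v \in `]0, u[ -> is_derive v 1 (x - y) (X (x v) - X (y v)).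
    by move=> /subset_itv_oo_cc/sub; exact: xyd.
  have zL v : v \in `]0, u[ -> `|X (x v) - X (y v)| <= L * `|(x - y) v| + 0.
    rewrite in_itv/= => /andP[v0 vu]; rewrite addr0; apply: Lr.
      move: td; rewrite !in_itv/= => /andP[_ td].
      by rewrite (ltW v0) (le_trans (ltW vu))// (le_trans ut).
    by have := small v; rewrite in_itv/= (ltW v0) vu lt_min => /(_ isT)/andP[].
  have := gronwall u0 (ltW L0) (lexx 0) zc zd zL.
  rewrite subr0 addr0 => grow; apply: le_lt_trans grow _.
  apply: le_lt_trans x0; rewrite mulrC ler_wpM2l//.
  apply: gronwall_const_le; first exact: ltW.
  by move: td; rewrite in_itv/= => /andP[_]; exact: le_trans.
- by apply: (continuous_comp (xyc u ut)); exact: norm_continuous.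
Qed.

Lemma Jac_mul (R : realType) (m n : nat) (f : 'cV[R]_n -> 'cV[R]_m)
    (x u : 'cV[R]_n) : Jac f x *m u = 'd f x u.
Proof.
rewrite [in RHS](matrix_sum_delta u) linear_sum; apply/colP => i.
rewrite mxE summxE; apply: eq_bigr => j _.
by rewrite big_ord1 linearZ !mxE mulrC.
Qed.

(** The error is relative to [f (x 0)]: a first Gronwall bound gives |z| <= K1 |z 0| for z = f(x).
    The difference u = z - w z(0) starts at 0 and satisfies u' = k(y) u + (k(x) - k(y)) z, whose
    source term is small compared with |z 0|; a second Gronwall bound concludes. *)
Lemma transported_estimate (R : realType) (m n : nat) (U : set 'cV[R]_n)
    (X : 'cV[R]_n -> 'cV[R]_n) (y : R -> 'cV[R]_n) (d : R)
    (f : 'cV[R]_n -> 'cV[R]_m) (k : 'cV[R]_n -> 'M[R]_m) (w : R -> 'M[R]_m) :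
  open U -> C1_on U X -> solution_on U X setT y -> 0 <= d ->
  (forall x, U x -> differentiable f x) ->
  (forall x, U x -> {for x, continuous k}) ->
  (forall x, U x -> Jac f x *m X x = k x *m f x) ->
  (forall t : R, is_derive t 1 w (k (y t) *m w t)) -> w 0 = 1%:M ->
  forall e : R, 0 < e -> exists2 r, 0 < r & forall x t,
    t \in `[0, d] -> solution_on U X `[0, t] x -> `|x 0 - y 0| < r ->
    `|f (x t) - w t *m f (x 0)| <= e * `|f (x 0)|.
Proof.
move=> Uo XC1 soly d0 fd kc fk wd w0 e e0.
have yc (t : R) : {for t, continuous y}.
  by have [_] := soly t I; exact: is_derive_continuous.
have Uy t : U (y t) by have [] := soly t I.
have kyc (t : R) : {for t, continuous (k \o y)}.
  exact: (continuous_comp (yc t) (kc _ (Uy t))).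
have [M M0 kM] := continuous_norm_bounded 0 d kyc.
(* [L1] controls the equation along [x], where [k] exceeds its bound along [y] by at most [e1 <= 1];
   [L2] controls it along [y]. The factor [m] comes from [ler_norm_mulmx]. *)
pose L1 := m%:R * (M + 1); pose L2 := m%:R * M.
have L10 : 0 <= L1 by rewrite mulr_ge0// addr_ge0.
have L20 : 0 <= L2 by rewrite mulr_ge0.
pose K1 := gronwall_const m L1 d; pose K2 := gronwall_const m L2 d.
have K1gt0 : 0 < K1 by rewrite (lt_le_trans ltr01)// gronwall_const_ge1.
have K2gt0 : 0 < K2 by rewrite (lt_le_trans ltr01)// gronwall_const_ge1.
(* The total loss of the two Gronwall bounds; [m.+1] in place of [m] keeps it positive for
   [m = 0]. *)
pose c := K2 * (m.+1%:R * K1).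
have c0 : 0 < c.
  by apply: mulr_gt0 K2gt0 _; apply: mulr_gt0 K1gt0; rewrite ltr0n.
pose e1 := Num.min 1 (e / c).
have e10 : 0 < e1 by rewrite lt_min ltr01 divr_gt0.
have [r1 r10 kr] := uniform_cvg_along_curve 0 d e10 yc (fun t => kc _ (Uy t)).
have [r r0 near_y] := flow_near_solution Uo XC1 soly d0 r10.
exists r => // x t td solx x0.
have [t0 t_le_d] : 0 <= t /\ t <= d by move: td; rewrite in_itv/= => /andP[].
have itv_d s : s \in `[0, t] -> s \in `[0, d].
  by apply: subitvPr; rewrite bnd_simp.
have kx s : s \in `[0, t] -> `|k (x s) - k (y s)| <= e1.
  move=> st; apply: kr; first exact: itv_d.
  apply: near_y x0; first exact: itv_d.
  move=> u us; apply: solx; apply: subitvPr us; rewrite bnd_simp.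
  by move: st; rewrite in_itv/= => /andP[].
pose z s := f (x s).
have zd (s : R) : s \in `[0, t] -> is_derive s 1 z (k (x s) *m z s).
  move=> st; have [Uxs xd] := solx s st.
  rewrite -fk// Jac_mul; apply: is_derive_comp_diff => //; exact: fd.
have zc (s : R) : s \in `[0, t] -> {for s, continuous z}.
  by move=> /zd; exact: is_derive_continuous.
have zK s : s \in `[0, t] -> `|z s| <= K1 * `|z 0|.
  rewrite in_itv/= => /andP[s0 st].
  have sub u : u \in `[0, s] -> u \in `[0, t].
    by apply: subitvPr; rewrite bnd_simp.
  have h1 : {within `[0, s], continuous z}.
    by apply: continuous_in_subspaceT => u; rewrite inE/= => /sub; exact: zc.
  have h2 (u : R) : u \in `]0, s[ -> is_derive u 1 z (k (x u) *m z u).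
    by move=> /subset_itv_oo_cc/sub; exact: zd.
  have h3 u : u \in `]0, s[ -> `|k (x u) *m z u| <= L1 * `|z u| + 0.
    move=> /subset_itv_oo_cc/sub ut; rewrite addr0.
    rewrite (le_trans (ler_norm_mulmx _ _))// -mulrA ler_wpM2l// ler_wpM2r//.
    rewrite -(subrK (k (y u)) (k (x u))) (le_trans (ler_normD _ _))// addrC.
    by rewrite lerD ?kM ?itv_d// (le_trans (kx u ut))// ge_min lexx.
  have := gronwall s0 L10 (lexx 0) h1 h2 h3.
  rewrite subr0 addr0 => h; apply: le_trans h _; rewrite ler_wpM2r//.
  by apply: gronwall_const_le => //; exact: le_trans t_le_d.
pose u s := z s - w s *m z 0.
have ud (s : R) : s \in `[0, t] ->
    is_derive s 1 u (k (x s) *m z s - k (y s) *m w s *m z 0).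
  move=> /zd zs; apply: is_deriveB.
  exact: (is_derive_linear (mulmxr (z 0)) (wd s)).
have uc : {within `[0, t], continuous u}.
  apply: continuous_in_subspaceT => s; rewrite inE/= => /ud.
  exact: is_derive_continuous.
have uL s : s \in `]0, t[ -> `|k (x s) *m z s - k (y s) *m w s *m z 0| <=
    L2 * `|u s| + m%:R * (e1 * (K1 * `|z 0|)).
  move=> /subset_itv_oo_cc st.
  have -> : k (x s) *m z s - k (y s) *m w s *m z 0 =
      k (y s) *m u s + (k (x s) - k (y s)) *m z s.
    by rewrite /u mulmxBl mulmxBr mulmxA [RHS]addrC subrKA.
  rewrite (le_trans (ler_normD _ _))// lerD// (le_trans (ler_norm_mulmx _ _))//.
    by rewrite -mulrA ler_wpM2l// ler_wpM2r// kM// itv_d.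
  by rewrite ler_wpM2l// ler_pM// ?kx ?zK.
have e2 : 0 <= m%:R * (e1 * (K1 * `|z 0|)).
  apply: mulr_ge0 => //; apply: (mulr_ge0 (ltW e10)).
  by apply: (mulr_ge0 (ltW K1gt0)).
have := gronwall t0 L20 e2 uc (fun s h => ud s (subset_itv_oo_cc h)) uL.
rewrite /u w0 mul1mx subrr normr0 add0r subr0 => h; apply: le_trans h _.
apply: (@le_trans _ _ (K2 * (m%:R * (e1 * (K1 * `|z 0|))))).
  by rewrite ler_wpM2r// gronwall_const_le.
apply: (@le_trans _ _ (e1 * c * `|z 0|)); last first.
  rewrite ler_wpM2r// -ler_pdivlMr//.
  by rewrite ge_min lexx orbT.
have m_le : m%:R <= m.+1%:R :> R by rewrite ler_nat.
have -> : e1 * c * `|z 0| = K2 * (m.+1%:R * (e1 * (K1 * `|z 0|))).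
  by rewrite /c; ring.
apply: (ler_wpM2l (ltW K2gt0)); apply: ler_wpM2r m_le.
apply: (mulr_ge0 (ltW e10)); exact: (mulr_ge0 (ltW K1gt0)).
Qed.

(** * Differentiability from first-order estimates *)

Lemma differentiable_near (R : realType) (V W : normedModType R)
    (f : V -> W) (x : V) (e : R) : differentiable f x -> 0 < e ->
  \forall y \near x, `|f y - f x - 'd f x (y - x)| <= e * `|y - x|.
Proof.
move=> /diff_locallyP[_ /eqaddoP fo] e0.
have := fo e e0 => h.
have : \forall y \near x, `|(f \o shift x - (cst (f x) + 'd f x)) (y - x)| <= e * `|y - x|.
  by rewrite (near_shift 0 x)/=; apply: filterS h => y/=; rewrite subr0 addrK.
by apply: filterS => y; rewrite !fctE/= subrK opprD addrA.
Qed.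

Lemma diff_of_near (R : realType) (V W : normedModType R)
    (f : V -> W) (x : V) (L : {linear V -> W}) : continuous L ->
  (forall e : R, 0 < e ->
    \forall y \near x, `|f y - f x - L (y - x)| <= e * `|y - x|) ->
  differentiable f x /\ 'd f x = L :> (V -> W).
Proof.
move=> Lc near_f.
have fo : f \o shift x = cst (f x) + L +o_ 0 id.
  apply/eqaddoP => e e0; have := near_f e e0.
  rewrite (near_shift 0 x)/= => h; apply: filterS h => y/=.
  by rewrite !fctE/= subr0 addrK opprD addrA.
have dfL : 'd f x = L :> (V -> W) by exact: diff_unique.
by split=> //; apply/diff_locallyP; rewrite dfL.
Qed.

Lemma differentiable_of_near (R : realType) (n m : nat)
    (f : 'cV[R]_n -> 'cV[R]_m) (x : 'cV[R]_n) (B : 'M[R]_(m, n)) :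
  (forall e : R, 0 < e ->
    \forall y \near x, `|f y - f x - B *m (y - x)| <= e * `|y - x|) ->
  differentiable f x /\ Jac f x = B.
Proof.
move=> near_f.
have [fd dfB] := diff_of_near (@continuous_linear_mx _ _ _ _ (mulmx B)) near_f.
split=> //; apply/matrixP => i j; rewrite mxE dfB/=.
by rewrite -colE mxE.
Qed.

(** Expanding [g] at [w0] on both sides of the hypothesis gives A (P w - w0) = M A (w - w0) up to
    errors small compared with |w - w0| and |P w - w0|. Inverting [A] and absorbing the second error
    gives a linear bound on |P w - w0|, which then makes all errors small compared with |w - w0|. *)
Lemma differentiable_conjugate (R : realType) (m : nat)
    (g P : 'cV[R]_m -> 'cV[R]_m) (w0 : 'cV[R]_m) (M : 'M[R]_m) :
  differentiable g w0 -> Jac g w0 \in unitmx -> g w0 = 0 ->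
  P w @[w --> w0] --> w0 ->
  (forall e : R, 0 < e ->
    \forall w \near w0, `|g (P w) - M *m g w| <= e * `|g w|) ->
  differentiable P w0 /\ Jac P w0 = invmx (Jac g w0) *m M *m Jac g w0.
Proof.
set A := Jac g w0 => gd Au gw0 Pc gP.
(* The neighbourhood filter is not punctured, so the limit is also the value at [w0]. *)
have Pw0 : P w0 = w0.
  apply/eqP; rewrite -subr_eq0 -normr_le0; apply/ler_addgt0Pl => e e0.
  rewrite addr0 distrC; move/cvgrPdist_le : Pc => /(_ e e0).
  exact: nbhs_singleton.
set B := _ *m A.
apply: differentiable_of_near => e e0.
pose a := m%:R * `|A|; pose b := m%:R * `|B|.
pose i := m%:R * `|invmx A|; pose c := m%:R * `|M|.
have a0 : 0 <= a by rewrite mulr_ge0.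
have b0 : 0 <= b by rewrite mulr_ge0.
have i0 : 0 <= i by rewrite mulr_ge0.
have c0 : 0 <= c by rewrite mulr_ge0.
pose C := 2 * (b + i * (c + a + 1)).
have C0 : 0 <= C by rewrite mulr_ge0// addr_ge0// mulr_ge0// !addr_ge0.
pose N := i * (c + a + 1 + C) + 1.
have N0 : 0 < N by rewrite /N ltr_wpDl// mulr_ge0// !addr_ge0.
(* The second bound makes [i * eta] at most 1/2, for the absorption; the third makes the final error
   at most [e]. The 1 added in [i + 1] and in [N] keeps the denominators positive. *)
pose eta := Num.min 1 (Num.min (2 * (i + 1))^-1 (e / N)).
have eta0 : 0 < eta.
  by rewrite !lt_min ltr01 invr_gt0 divr_gt0// mulr_gt0// ltr_wpDl.
have eta1 : eta <= 1 by rewrite ge_min lexx.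
have etai : i * eta <= 2^-1.
  have : eta <= (2 * (i + 1))^-1 by rewrite /eta !ge_min lexx orbT.
  rewrite -[_^-1]mul1r ler_pdivlMr ?mulr_gt0 ?ltr_wpDl// => h.
  rewrite -[leRHS]mul1r ler_pdivlMr//; nra.
have etae : i * eta * (c + a + 1 + C) <= e.
  have : eta <= e / N by rewrite /eta !ge_min lexx !orbT.
  rewrite ler_pdivlMr// /N => h; nra.
have near_g := differentiable_near gd eta0.
have near_gP : \forall w \near w0,
    `|g (P w) - g w0 - 'd g w0 (P w - w0)| <= eta * `|P w - w0|.
  exact: Pc near_g.
near=> w.
have h1 : `|g (P w) - A *m (P w - w0)| <= eta * `|P w - w0|.
  by rewrite Jac_mul -[g (P w)]subr0 -gw0; near: w.
have h2 : `|g w - A *m (w - w0)| <= eta * `|w - w0|.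
  by rewrite Jac_mul -[X in X - 'd _ _ _]subr0 -gw0; near: w.
have h3 : `|g (P w) - M *m g w| <= eta * `|g w|.
  by near: w; exact: gP.
rewrite Pw0.
pose E1 := g (P w) - A *m (P w - w0); pose E2 := g (P w) - M *m g w.
pose E3 := g w - A *m (w - w0).
(* In this combination of the three errors the values [g (P w)] and [g w] cancel. *)
have key : P w - w0 - B *m (w - w0) = invmx A *m (M *m E3 + E2 - E1).
  have -> : M *m E3 + E2 - E1 = A *m (P w - w0) - M *m (A *m (w - w0)).
    rewrite /E1 /E2 /E3 mulmxBr.
    by apply/matrixP => ? ?; rewrite !mxE; ring.
  by rewrite [RHS]mulmxBr mulKmx// /B !mulmxA.
have gw : `|g w| <= (a + 1) * `|w - w0|.
  rewrite -(subrK (A *m (w - w0)) (g w)) (le_trans (ler_normD _ _))// addrC mulrDl.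
  rewrite lerD//; first by rewrite (le_trans (ler_norm_mulmx _ _))// mulrA.
  by rewrite (le_trans h2)// ler_wpM2r.
have E3M : `|M *m E3| <= c * (eta * `|w - w0|).
  by rewrite (le_trans (ler_norm_mulmx _ _))// mulrA ler_wpM2l.
have E2g : `|E2| <= eta * ((a + 1) * `|w - w0|).
  by rewrite (le_trans h3)// ler_wpM2l// ltW.
have bound : `|P w - w0 - B *m (w - w0)| <=
    i * eta * ((c + a + 1) * `|w - w0| + `|P w - w0|).
  rewrite key; apply: le_trans (ler_norm_mulmx _ _) _.
  rewrite [leLHS]mulrA -[leRHS]mulrA; apply: ler_wpM2l => //.
  apply: le_trans (ler_normB _ _) _.
  have := ler_normD (M *m E3) E2; have : `|E1| <= eta * `|P w - w0| by [].
  by move: E3M E2g; lra.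
(* Half of |P w - w0| moves to the left-hand side, whence the factor 2 in [C]. *)
have Pw : `|P w - w0| <= C * `|w - w0|.
  have : `|P w - w0| <= b * `|w - w0| + `|P w - w0 - B *m (w - w0)|.
    rewrite -{1}(subrK (B *m (w - w0)) (P w - w0)) (le_trans (ler_normD _ _))//.
    by rewrite addrC lerD// (le_trans (ler_norm_mulmx _ _))// mulrA.
  have : i * eta * ((c + a + 1) * `|w - w0|) <= i * ((c + a + 1) * `|w - w0|).
    rewrite -[i * eta * _]mulrA ler_wpM2l// ler_piMl// mulr_ge0//.
    by rewrite !addr_ge0.
  have : i * eta * `|P w - w0| <= 2^-1 * `|P w - w0| by rewrite ler_wpM2r.
  rewrite /C; lra.
apply: (le_trans bound); apply: (@le_trans _ _ (i * eta * ((c + a + 1 + C) * `|w - w0|))).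
  rewrite ler_wpM2l//; first by rewrite mulr_ge0// ltW.
  by rewrite [leRHS]mulrDl lerD.
by rewrite mulrA ler_wpM2r.
Unshelve. all: by end_near. Qed.

(** * Transversality and eigenvalues of conjugate matrices *)

(** [J] has rank n - 1, so its kernel is the line spanned by [X]. The range of [D] misses [X], hence
    meets this line only in 0, and [D] is injective. Transposes appear because [kermx] is a left
    kernel. *)
Lemma unitmx_transversal (F : fieldType) (m n : nat) (J : 'M[F]_(m, n))
    (D : 'M[F]_(n, m)) (X : 'cV[F]_n) :
  m.+1 = n -> row_free J -> (forall u : 'cV_m, D *m u = 0 -> u = 0) ->
  J *m X = 0 -> (forall u : 'cV_m, D *m u != X) -> J *m D \in unitmx.
Proof.
move=> mn Jfree Dinj JX XD.
have X0 : X != 0 by have := XD 0; rewrite mulmx0 eq_sym.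
rewrite -unitmx_tr -row_free_unit; apply: inj_row_free => v.
rewrite trmx_mul mulmxA => vDJ.
have rankX : \rank X^T = 1%N.
  by rewrite rank_rV -trmx0 (inj_eq trmx_inj) X0.
have XK : (X^T <= kermx J^T)%MS.
  by apply/sub_kermxP; rewrite -trmx_mul JX trmx0.
have KX : (kermx J^T <= X^T)%MS.
  rewrite -(mxrank_leqif_sup XK).2 rankX mxrank_ker mxrank_tr.
  by move: Jfree; rewrite /row_free => /eqP ->; rewrite -mn subSnn.
have /sub_rVP[a vDa] : (v *m D^T <= X^T)%MS.
  by apply: submx_trans KX; apply/sub_kermxP.
have Dv : D *m v^T = a *: X.
  by apply: trmx_inj; rewrite trmx_mul trmxK vDa linearZ.
have [a0|a0] := eqVneq a 0.
  by apply: trmx_inj; rewrite trmx0; apply: Dinj; rewrite Dv a0 scale0r.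
have /negP[] := XD (a^-1 *: v^T).
by rewrite -scalemxAr Dv scalerA mulVf// scale1r.
Qed.

Lemma char_poly_conj (F : fieldType) (n : nat) (C B : 'M[F]_n) :
  C \in unitmx -> char_poly (invmx C *m B *m C) = char_poly B.
Proof.
move=> Cu; pose Cp := map_mx polyC C; pose Cip := map_mx polyC (invmx C).
have CC : Cip *m Cp = 1%:M by rewrite -map_mxM mulVmx// map_mx1.
rewrite /char_poly.
have -> : char_poly_mx (invmx C *m B *m C) = Cip *m char_poly_mx B *m Cp.
  rewrite /char_poly_mx !map_mxM mulmxBr mulmxBl -/Cp -/Cip; congr (_ - _).
  by rewrite scalar_mxC -mulmxA CC mulmx1.
by rewrite !det_mulmx mulrC mulrA -det_mulmx mulmx1C// det1 mul1r.
Qed.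

(** An equality of lists, not only up to order: [eigenvalues] depends on the matrix only through its
    characteristic polynomial. *)
Lemma eigenvalues_conj (R : realType) (n : nat) (C B : 'M[R]_n) :
  C \in unitmx -> eigenvalues (invmx C *m B *m C) = eigenvalues B.
Proof.
by move=> Cu; rewrite /eigenvalues -!map_char_poly char_poly_conj.
Qed.

Lemma Jac_comp (R : realType) (l m n : nat) (f : 'cV[R]_n -> 'cV[R]_m)
    (s : 'cV[R]_l -> 'cV[R]_n) (x : 'cV[R]_l) :
  differentiable s x -> differentiable f (s x) ->
  Jac (f \o s) x = Jac f (s x) *m Jac s x.
Proof.
move=> sd fd; apply/matrixP => i j.
have -> : (Jac f (s x) *m Jac s x) i j =
    (Jac f (s x) *m Jac s x *m delta_mx j (0 : 'I_1)) i 0.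
  by rewrite -colE [RHS]mxE.
by rewrite -mulmxA !Jac_mul [LHS]mxE diff_comp.
Qed.

(** * Fundamental matrices *)

(** A vector killed by [v t] gives a solution vanishing at time [t], hence at time 0 by backward
    uniqueness. *)
Lemma fundamental_unitmx (R : realType) (m : nat) (B v : R -> 'M[R]_m) (t : R) :
  (forall s : R, {for s, continuous B}) ->
  (forall s : R, is_derive s 1 v (B s *m v s)) -> v 0 = 1%:M -> 0 <= t ->
  v t \in unitmx.
Proof.
move=> Bc vd v0 t0; rewrite -unitmx_tr -row_free_unit; apply: inj_row_free => u uv.
apply: trmx_inj; rewrite trmx0 -[u^T]mul1mx -v0.
apply: (linear_ode_eq0_rev (y := fun s => v s *m u^T) Bc _ t0).
  by move=> s; rewrite mulmxA; exact: (is_derive_linear (mulmxr u^T) (vd s)).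
by apply: trmx_inj; rewrite trmx_mul trmxK uv trmx0.
Qed.

(** As functions of [t] both sides solve the same equation, by periodicity of [B], and they agree at
    0. Uniqueness is applied to each column of the difference. *)
Lemma fundamental_period (R : realType) (m : nat) (B v : R -> 'M[R]_m) (T t : R) :
  (forall s : R, {for s, continuous B}) -> (forall s, B (s + T) = B s) ->
  (forall s : R, is_derive s 1 v (B s *m v s)) -> v 0 = 1%:M -> 0 <= t ->
  v (t + T) = v t *m v T.
Proof.
move=> Bc BT vd v0 t0; apply/matrixP => i j.
pose c : 'cV[R]_m := delta_mx j 0.
pose D s := v (1 * s + T) *m c - v s *m (v T *m c).
have Dd (s : R) : is_derive s 1 D (B s *m D s).
  have h1 : is_derive s 1 (fun s => v (1 * s + T)) (B s *m v (1 * s + T)).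
    have -> : B s = B (1 * s + T) by rewrite mul1r BT.
    by rewrite -[_ *m _]scale1r; exact: is_derive_comp_affine.
  have -> : B s *m D s = B s *m v (1 * s + T) *m c - B s *m v s *m (v T *m c).
    by rewrite /D/= mulmxBr !mulmxA.
  apply: is_deriveB; first exact: (is_derive_linear (mulmxr c) h1).
  exact: (is_derive_linear (mulmxr (v T *m c)) (vd s)).
have D0 : D 0 = 0 by rewrite /D mulr0 add0r v0 mul1mx subrr.
have /eqP := linear_ode_eq0 Bc Dd t0 D0.
rewrite /D mul1r subr_eq0 mulmxA -!colE => /eqP/colP/(_ i).
by rewrite !mxE.
Qed.

(** * The section in its chart and the derivative of the Poincare map *)

(** Moves statements about points of the section near [p] to the parameter domain, through
    continuity of [sigma]; full neighbourhoods replace [within]. *)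
Lemma near_section (R : realType) (d n : nat) (S : set 'cV[R]_n) (p : 'cV[R]_n)
    W (sigma : 'cV[R]_d -> 'cV[R]_n) kappa (A : set 'cV[R]_n) :
  local_param S p W sigma kappa -> (\forall q \near within S (nbhs p), A q) ->
  \forall w \near kappa p, A (sigma w).
Proof.
move=> [Sp [Wo sC1] _ [sK _] [V [_ Vp SV]]] nearA.
have [w0 Ww0 sw0] : (sigma @` W) p by rewrite -SV.
rewrite -sw0 sK//.
have nearW : \forall w \near w0, W w by move: Wo; rewrite openE; exact.
have sc : {for w0, continuous sigma}.
  by apply: differentiable_continuous; exact: (sC1 w0 Ww0).1.
have nearSA : \forall q \near sigma w0, S q -> A q by rewrite sw0.
have := sc _ nearSA; apply: filterS2 nearW => w Ww; apply.
suff : (S `&` V) (sigma w) by case.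
by rewrite SV; exists w.
Qed.

Theorem theorem2 (R : realType) (n : nat) (n_ge2 : (2 <= n)%N)
    (U : set 'cV[R]_n) (U_open : open U) (U_nonempty : U !=set0)
    (X : 'cV[R]_n -> 'cV[R]_n) (X_C1 : C1_on U X)
    (T : R) (T_gt0 : 0 < T)
    (gamma : R -> 'cV[R]_n) (gamma_periodic : periodic_solution U X T gamma)
    (f : 'cV[R]_n -> 'cV[R]_n.-1) (f_C1 : C1_on U f)
    (f_vanishes : orbit_of T gamma `<=`
       \bigcap_(i in [set: 'I_n.-1]) [set x | U x /\ f x i 0 = 0])
    (f_transversal : forall x, orbit_of T gamma x -> row_free (Jac f x))
    (k : 'cV[R]_n -> 'M[R]_n.-1) (k_C1 : C1_on U k)
    (f_invariant : forall x, U x -> Jac f x *m X x = k x *m f x)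
    (v : R -> 'M[R]_n.-1)
    (v_derive : forall t : R, is_derive t 1 v (k (gamma t) *m v t))
    (v0 : v 0 = 1%:M) :
  characteristic_multipliers U X T gamma (eigenvalues (v T)).
Proof.
move=> p S W sigma kappa tau orbit_p [chart transversal] [returns tauT].
have [Sp [Wo sC1] sinj [sK kappa_c] [V [Vo Vp SV]]] := chart.
have [gamma_sol gammaT _] := gamma_periodic.
have [t0 + gamma_t0] := orbit_p; rewrite /= in_itv/= => /andP[t0_ge0 _].
have [w0 Ww0 sw0] : (sigma @` W) p by rewrite -SV.
have kp : kappa p = w0 by rewrite -sw0 sK.
rewrite /tangent_space kp in transversal.
rewrite kp; set P := in_chart _ _ _.
(* The periodic solution restarted at [p]. *)
pose y s := gamma (1 * s + t0).
have y0 : y 0 = p by rewrite /y mulr0 add0r.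
have yT : y T = p by rewrite /y mul1r addrC gammaT.
have soly : solution_on U X setT y.
  move=> s _; have [Uys yd] := gamma_sol (1 * s + t0) I; split=> //.
  by rewrite -[X _]scale1r; exact: is_derive_comp_affine.
have Up : U p by rewrite -y0; exact: (soly 0 I).1.
have kc x : U x -> {for x, continuous k}.
  by move=> Ux; apply: differentiable_continuous; exact: (k_C1 x Ux).1.
have fd x : U x -> differentiable f x by move=> Ux; exact: (f_C1 x Ux).1.
have sd : differentiable sigma w0 by exact: (sC1 w0 Ww0).1.
have Bc (s : R) : {for s, continuous (k \o gamma)}.
  have [Us gd] := gamma_sol s I.
  exact: (continuous_comp (is_derive_continuous gd) (kc _ Us)).
have vt0 : v t0 \in unitmx by exact: (fundamental_unitmx Bc v_derive).
have vT : v (t0 + T) = v t0 *m v T.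
  by apply: (fundamental_period Bc _ v_derive) => // s /=; rewrite gammaT.
(* The transition matrix along [y], normalised to the identity at time 0; over one period it is
   [M]. *)
pose w s := v (1 * s + t0) *m invmx (v t0).
pose M := v t0 *m v T *m invmx (v t0).
have w_0 : w 0 = 1%:M by rewrite /w mulr0 add0r mulmxV.
have w_T : w T = M by rewrite /w mul1r addrC vT.
have wd (s : R) : is_derive s 1 w (k (y s) *m w s).
  rewrite mulmxA; apply: (is_derive_linear (mulmxr (invmx (v t0)))).
  by rewrite -[_ *m _]scale1r; exact: is_derive_comp_affine.
have fp : f p = 0.
  by apply/colP => i; rewrite mxE; exact: (f_vanishes p orbit_p i I).2.
pose g := f \o sigma.
have fds : differentiable f (sigma w0) by rewrite sw0; exact: fd.
have gd : differentiable g w0 by exact: differentiable_comp.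
have g0 : g w0 = 0 by rewrite /g/= sw0.
have gU : Jac g w0 \in unitmx.
  rewrite Jac_comp// sw0; apply: (@unitmx_transversal _ _ _ _ _ (X p)).
  - by rewrite prednK// (leq_trans _ n_ge2).
  - exact: f_transversal.
  - by move=> u; rewrite Jac_mul => u0; apply: (sinj w0 Ww0); rewrite u0 linear0.
  - by rewrite f_invariant// fp mulmx0.
  - move=> u; apply/eqP => uX; apply: transversal; exists u => //.
    by rewrite -Jac_mul.
(* Return times near [p] differ from [T] by less than min(T, 1), so they lie in [[0, d]]. *)
pose d := T + 1.
have d0 : 0 <= d by rewrite addr_ge0// ltW.
pose Pi w := flow U X (tau (sigma w)) (sigma w).
have near_tau (e : R) : 0 < e -> \forall w \near w0, `|T - tau (sigma w)| < e.
  move=> e0; rewrite -kp; apply: (near_section (A := fun q => `|T - tau q| < e) chart).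
  by move/cvgrPdist_lt : tauT => /(_ e e0).
have near_sigma (e : R) : 0 < e -> \forall w \near w0, `|sigma w - p| < e.
  move=> e0; have /cvgrPdist_lt/(_ e e0) := differentiable_continuous sd.
  by rewrite sw0; apply: filterS => z; rewrite distrC.
have near_flow : \forall z \near w0, exists2 x, solution_on U X `[0, tau (sigma z)] x &
    [/\ tau (sigma z) \in `[0, d], x 0 = sigma z & x (tau (sigma z)) = Pi z].
  have tmin : 0 < Num.min T 1 by rewrite lt_min T_gt0 ltr01.
  have := near_tau _ tmin.
  have : \forall z \near w0, flow_dom U X (tau (sigma z)) (sigma z).
    rewrite -kp; apply: (near_section (A := fun q => flow_dom U X (tau q) q) chart).
    by apply: filterS returns => q [].
  apply: filterS2 => z zdom; rewrite lt_min ltr_norml => /andP[/andP[h1 h2] h3].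
  (* The value chosen by [xget] is reached by some solution; the estimates above hold for every
     solution starting close to [p]. *)
  have [a [b [x [/andP[a0 b0] /andP[at_ tb] solx x0 xt]]]] :
    flow_graph U X (tau (sigma z)) (sigma z) (Pi z) by exact: (xgetPex 0 zdom).
  exists x.
    move=> s; rewrite /= in_itv/= => /andP[s0 st]; apply: solx.
    by rewrite /= in_itv/= (lt_le_trans a0)// (le_lt_trans st).
  split=> //; rewrite in_itv/= /d; move: h3; rewrite ltr_norml => /andP[h3 h4].
  by apply/andP; split; lra.
have Pi_c : Pi z @[z --> w0] --> p.
  apply/(@cvgrPdist_lt _ _ _ (nbhs w0)) => e e0.
  have e2 : 0 < e / 2 by rewrite divr_gt0.
  have [r r0 near_y] := flow_near_solution U_open X_C1 soly d0 e2.
  have yc : {for T, continuous y} by have [_] := soly T I; exact: is_derive_continuous.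
  have /cvgrPdist_lt/(_ _ e2)/nbhs_ballP[r' /= r'0 yr] := yc.
  have near_r := near_sigma _ r0; have near_r' := near_tau _ r'0.
  near=> z.
  have [x solx [td x0 xt]] : exists2 x, solution_on U X `[0, tau (sigma z)] x &
    [/\ tau (sigma z) \in `[0, d], x 0 = sigma z & x (tau (sigma z)) = Pi z].
    by near: z.
  (* Two errors: the time error along [y], as the return time tends to [T], and the distance of [x]
     from [y] at equal times. *)
  rewrite -(subrKA (y (tau (sigma z)))) (le_lt_trans (ler_normD _ _))//.
  rewrite [ltRHS]splitr ltrD//.
    by rewrite -yT; apply: yr; rewrite -ball_normE/=; near: z.
  rewrite distrC -xt; apply: near_y => //; rewrite x0 y0; by near: z.
(* On this image [kappa] is continuous and inverts [sigma]; outside it nothing is known of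
   [kappa]. *)
have near_image : \forall z \near w0, (sigma @` W) (Pi z).
  have : \forall z \near w0, V (Pi z).
    by apply: Pi_c; move: Vo; rewrite openE; exact.
  have : \forall z \near w0, S (Pi z).
    rewrite -kp; apply: (near_section (A := fun q => S (flow U X (tau q) q)) chart).
    by apply: filterS returns => q [].
  by apply: filterS2 => z Sz Vz; rewrite -SV.
have Pc : P z @[z --> w0] --> w0.
  move=> N; rewrite -{1}kp => kN.
  have : within (sigma @` W) (nbhs p) (kappa @^-1` N).
    move/subspace_continuousP : kappa_c => /(_ p); apply => //.
    by exists w0.
  move=> /Pi_c; apply: filterS2 near_image => z im; exact.
have gP (e : R) : 0 < e -> \forall z \near w0, `|g (P z) - M *m g z| <= e * `|g z|.
  move=> e0; have e2 : 0 < e / 2 by rewrite divr_gt0.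
  have [r r0 near_f] := transported_estimate U_open X_C1 soly d0 fd kc f_invariant
    wd w_0 e2.
  (* Half of [e] pays for replacing [w (tau (sigma z))] by [w T]; the division offsets the factor
     [n.-1] lost in a matrix product. *)
  have em : 0 < e / 2 / n.-1.+1%:R by rewrite divr_gt0.
  have := is_derive_continuous (wd T).
  move=> /cvgrPdist_lt/(_ _ em)/nbhs_ballP[r' /= r'0 wr].
  have near_r := near_sigma _ r0; have near_r' := near_tau _ r'0.
  near=> z.
  have [x solx [td x0 xt]] : exists2 x, solution_on U X `[0, tau (sigma z)] x &
    [/\ tau (sigma z) \in `[0, d], x 0 = sigma z & x (tau (sigma z)) = Pi z].
    by near: z.
  have -> : g (P z) = f (x (tau (sigma z))).
    rewrite xt; have [z' Wz' sz'] : (sigma @` W) (Pi z) by near: z.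
    by rewrite /g /P /in_chart/= /poincare_map -/(Pi z) -sz' sK.
  have h1 : `|f (x (tau (sigma z))) - w (tau (sigma z)) *m g z| <= e / 2 * `|g z|.
    by have := near_f x _ td solx; rewrite x0 y0; apply; near: z.
  have h2 : `|M - w (tau (sigma z))| <= e / 2 / n.-1.+1%:R.
    by rewrite -w_T; apply: ltW; apply: wr; rewrite -ball_normE/=; near: z.
  have h3 : `|(w (tau (sigma z)) - M) *m g z| <= e / 2 * `|g z|.
    apply: le_trans (ler_norm_mulmx _ _) _; rewrite mulrA ler_wpM2r// distrC.
    apply: (@le_trans _ _ (n.-1.+1%:R * (e / 2 / n.-1.+1%:R))).
      by rewrite ler_pM// ler_nat.
    by rewrite mulrC divfK.
  rewrite -(subrKA (w (tau (sigma z)) *m g z)) -mulmxBl.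
  by apply: le_trans (ler_normD _ _) _; rewrite (splitr e) mulrDl lerD.
have [Pd ->] := differentiable_conjugate gd gU g0 Pc gP.
(* Two conjugations are removed in turn: by [Jac g w0], then by the inverse of [v t0], which is why
   [v t0] is rewritten as a double inverse. *)
split=> //; rewrite eigenvalues_conj// /M.
rewrite -{1}[v t0]invmxK eigenvalues_conj ?unitmx_inv//.
Unshelve. all: by end_near. Qed.
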